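(* Let $(J,\mathcal{B})$ be a standard Borel space, let $\alpha,\beta\in\mathcal{M}(\mathcal{B}^2)$ with $\alpha\le\beta$, and let $\varphi\colon\mathcal{B}\to\mathbb{R}$ be a bounded continuous submodular set function with $\varphi(\emptyset)=\varphi(J)=0$. Let $$\mathcal{F}_\varphi(J,\mathcal{B},\alpha,\beta)=\{\mu\in\mathcal{M}(\mathcal{B}^2):\ \alpha\le\mu\le\beta,\ \partial\mu\le\varphi\text{ on }\mathcal{B}\}.$$ For $\mu\in\mathcal{F}_\varphi(J,\mathcal{B},\alpha,\beta)$ put $$\eta=(\beta-\mu)\wedge(\mu-\alpha),\qquad R=\eta+\eta^*,\qquad T=\eta\wedge\eta^*.$$ Then $\mu$ is an extreme point of $\mathcal{F}_\varphi(J,\mathcal{B},\alpha,\beta)$ if and only if the following two statements hold: (1) $\mathsf{bmm}(\kappa_{-\eta,\eta})\cap\mathsf{bmm}(\varphi-\partial\mu)\cap\mathsf{bmm}((\varphi-\partial\mu)^c)=\{0\}$; (2) $T=0$, and there is no reduced circulation $\gamma$ such that $0<\gamma\le R$. Here $(\varphi-\partial\mu)^c(X):=(\varphi-\partial\mu)(X^c)$ for $X\in\mathcal{B}$.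
   Context: $\mathcal{M}(\mathcal{B}^2)$ is the set of finite signed measures on $(J\times J,\mathcal{B}^2)$, where $\mathcal{B}^2$ is the product Borel $\sigma$-algebra; $\mu\le\nu$ means $\nu-\mu$ is a nonnegative measure, and $0<\gamma$ means $\gamma$ is a nonzero nonnegative measure. $X^c=J\setminus X$. The boundary of $\mu$ is $\partial\mu(X)=\mu(X\times X^c)-\mu(X^c\times X)$, $X\in\mathcal{B}$. The meet of signed measures is $(\mu\wedge\nu)(X)=\inf\{\mu(X_1)+\nu(X_2): X=X_1\sqcup X_2\}$ over measurable partitions. The transpose $\mu^*$ is defined by $\mu^*(E)=\mu(E^* )$ with $E^*=\{(x,y):(y,x)\in E\}$. A circulation is $\gamma\in\mathcal{M}(\mathcal{B}^2)$ with equal marginals, $\gamma(X\times J)=\gamma(J\times X)$ for all $X\in\mathcal{B}$. A nonnegative measure $\gamma$ on $J\times J$ is reduced if $\gamma\wedge\gamma^*=0$. A set function $\varphi$ is submodular if $\varphi(A)+\varphi(B)\ge\varphi(A\cap B)+\varphi(A\cup B)$ for all $A,B\in\mathcal{B}$, and continuous if $\varphi(A_n)\to\varphi(A)$ whenever $A,A_n\in\mathcal{B}$ and $\mathbf{1}_{A_n}\to\mathbf{1}_A$ pointwise on $J$. For $\alpha'\le\beta'$ in $\mathcal{M}(\mathcal{B}^2)$, the cut function is $\kappa_{\alpha',\beta'}(X)=\beta'(X\times X^c)-\alpha'(X^c\times X)$, $X\in\mathcal{B}$. A charge is a finitely additive real-valued set function on $\mathcal{B}$; for a submodular $\psi$ with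 $\psi(\emptyset)=0$, $\mathsf{bmm}(\psi)$ is the set of charges $\delta$ on $\mathcal{B}$ with $\delta\le\psi$ on $\mathcal{B}$ and $\delta(J)=\psi(J)$. A point of a convex set $K$ is extreme if it is not the midpoint of two distinct points of $K$. *)

(* Defs.v *)
From HB Require Import structures.
From mathcomp Require Import all_boot all_order all_algebra.
From mathcomp Require Import all_classical all_reals all_analysis.
Import Order.TTheory GRing.Theory Num.Theory.
Import numFieldNormedType.Exports.

Set Implicit Arguments.
Unset Strict Implicit.
Unset Printing Implicit Defensive.

Local Open Scope classical_set_scope.
Local Open Scope ring_scope.
Local Open Scope ereal_scope.

Definition polish (R : realType) (P : metricType R) : Prop :=
  (forall F : set_system P, ProperFilter F -> cauchy F ->
     exists x : P, F --> x) /\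
  (exists2 D : set P, countable D & dense D).

(* The sigma-algebra of J is the Borel sigma-algebra of a Polish space, carried
   to J along a bijection. *)
Definition standard_borel (R : realType) d (J : measurableType d) : Prop :=
  exists (P : metricType R) (f : J -> P),
    [/\ polish P, bijective f &
        forall B : set P, <<s [set U : set P | open U] >> B <->
                          measurable (f @^-1` B)].

(* A finite signed measure is a {charge set _ -> \bar R}.  Its values on
   non-measurable sets are junk, so that equality and order of set functions are
   only ever tested on measurable sets. *)
Definition sf_le (R : realType) d (T : measurableType d)
    (mu nu : set T -> \bar R) : Prop :=
  forall E, measurable E -> mu E <= nu E.

Definition sf_eq (R : realType) d (T : measurableType d)
    (mu nu : set T -> \bar R) : Prop :=
  forall E, measurable E -> mu E = nu E.

Definition sf_meet (R : realType) d (T : measurableType d)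
    (mu nu : set T -> \bar R) : set T -> \bar R :=
  fun X => ereal_inf [set r | exists X1 X2 : set T,
    [/\ measurable X1, measurable X2, X1 `&` X2 = set0, X1 `|` X2 = X &
        r = mu X1 + nu X2]].

Definition transpose (R : realType) (J : Type)
    (mu : set (J * J)%type -> \bar R) : set (J * J)%type -> \bar R :=
  fun E => mu [set xy | E (xy.2, xy.1)].

Definition boundary (R : realType) (J : Type)
    (mu : set (J * J)%type -> \bar R) : set J -> \bar R :=
  fun X => mu (X `*` ~` X) - mu (~` X `*` X).

Definition cut_function (R : realType) (J : Type)
    (alpha beta : set (J * J)%type -> \bar R) : set J -> \bar R :=
  fun X => beta (X `*` ~` X) - alpha (~` X `*` X).

Definition circulation (R : realType) d (J : measurableType d)
    (gamma : {charge set (J * J)%type -> \bar R}) : Prop :=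
  forall X : set J, measurable X ->
    gamma (X `*` [set: J]) = gamma ([set: J] `*` X).

Definition reduced (R : realType) d (J : measurableType d)
    (gamma : {charge set (J * J)%type -> \bar R}) : Prop :=
  sf_eq (sf_meet gamma (transpose gamma)) (cst 0).

Definition sf_bounded (R : realType) d (J : measurableType d)
    (phi : set J -> R) : Prop :=
  exists M : R, forall X, measurable X -> (`|phi X| <= M)%R.

Definition submodular (R : realType) d (J : measurableType d)
    (phi : set J -> R) : Prop :=
  forall A B, measurable A -> measurable B ->
    (phi (A `&` B) + phi (A `|` B) <= phi A + phi B)%R.

Definition sf_continuous (R : realType) d (J : measurableType d)
    (phi : set J -> R) : Prop :=
  forall (A : set J) (A_ : (set J)^nat),
    measurable A -> (forall n, measurable (A_ n)) ->
    (forall x : J, (\1_(A_ n) x : R) @[n --> \oo] --> (\1_A x : R)) ->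
    phi (A_ n) @[n --> \oo] --> phi A.

(* An {additive_charge set _ -> \bar R} is finitely additive and finite on
   measurable sets. *)
Definition bmm (R : realType) d (J : measurableType d)
    (psi : set J -> \bar R) : set ({additive_charge set J -> \bar R}) :=
  [set delta | sf_le delta psi /\ delta [set: J] = psi [set: J]].

Definition sf_compl (R : realType) (J : Type)
    (psi : set J -> \bar R) : set J -> \bar R :=
  fun X => psi (~` X).

Definition flows (R : realType) d (J : measurableType d) (phi : set J -> R)
    (alpha beta : {charge set (J * J)%type -> \bar R}) :
    set ({charge set (J * J)%type -> \bar R}) :=
  [set mu | [/\ sf_le alpha mu, sf_le mu beta &
                sf_le (boundary mu) (EFin \o phi)]].

Definition extreme_point (R : realType) d (T : measurableType d)
    (K : set ({charge set T -> \bar R})) (mu : {charge set T -> \bar R}) : Prop :=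
  K mu /\
  ~ exists mu1 mu2 : {charge set T -> \bar R},
      [/\ K mu1, K mu2, ~ sf_eq mu1 mu2 &
          sf_eq mu (fun E => (2^-1)%:E * (mu1 E + mu2 E))].

(* Main.v *)
Require Import Defs.
From HB Require Import structures.
From mathcomp Require Import all_boot all_order all_algebra.
From mathcomp Require Import all_classical all_reals all_analysis.
From mathcomp Require Import measurable_realfun ring lra.
Import Order.TTheory GRing.Theory Num.Theory.
Import numFieldNormedType.Exports.

(** A segment centred at [mu] stays in the polytope of flows exactly when its
    half-length [nu] satisfies [-eta <= nu <= eta] and [-psi <= boundary nu <= psi]
    ([extreme_flowP]).  So [mu] is extreme iff [nu = 0] is the only such
    perturbation, and the two conditions of the theorem split this into the
    possible values of the boundary and the perturbations with zero boundary.

    Boundaries.  The boundary of a perturbation is a charge [delta] below the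
    cut function of [(-eta, eta)], below [psi] and below its complement.
    Conversely every such [delta] is the boundary of some perturbation
    ([cut_lift]): a measure version of the feasible flow theorem.  Its proof
    is by duality.  Domination by the cut function makes [delta] countably
    additive, so simple functions can be integrated against it, and the coarea
    formula turns the cut inequality into
    [int f d delta <= int |f x - f y| d eta(x, y)] for simple [f] ([coarea]).
    Hence sending [f x - f y] to [int f d delta] is a linear functional
    dominated by the norm of L1(eta).  A Hahn-Banach extension, evaluated on
    indicators, is an additive set function [nu] with [|nu| <= eta], which is
    countably additive for that reason, and its boundary is [delta].  Thus
    condition (1) says that all perturbations have zero boundary.

    Circulations.  If [eta] and its transpose have a nonzero meet, this meet is
    symmetric, so it is itself a perturbation with zero boundary.  Otherwise
    they are carried by complementary sets [~` G] and [G], and reversing the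
    arrows of the negative part is a dictionary between nonzero signed
    circulations [nu] with [|nu| <= eta] and nonzero reduced circulations
    [gamma <= eta + transpose eta] ([fold_circulation], [unfold_circulation]).
    Thus condition (2) says that the only perturbation with zero boundary
    is zero. *)

Set Implicit Arguments.
Unset Strict Implicit.
Unset Printing Implicit Defensive.

Local Open Scope classical_set_scope.
Local Open Scope ring_scope.

(** * Hahn-Banach extension of dominated linear graphs *)

Section HahnBanach.
Context (R : realType) (E : lmodType R) (M : set E) (p : E -> R).
Hypothesis M_lin : forall a u v, M u -> M v -> M (a *: u + v).
Hypothesis pD : forall u v, M u -> M v -> p (u + v) <= p u + p v.
Hypothesis pZ : forall a u, M u -> 0 < a -> p (a *: u) = a * p u.

(** Partial linear functionals are encoded by their graphs: domination by [p]
    already forces such a graph to be single-valued, so a functional may be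
    given by a formula on representatives without checking that it is
    well defined. *)
Definition dominated_graph (G : set (E * R)) :=
  [/\ G (0, 0),
      forall u r, G (u, r) -> M u /\ r <= p u &
      forall a u r v s, G (u, r) -> G (v, s) -> G (a *: u + v, a * r + s)].

Let dominated_graph_fun G u r s : dominated_graph G -> G (u, r) -> G (u, s) ->
  r = s.
Proof.
move=> [G0 Gp Glin] Gr Gs.
have Gsub a b : G (u, a) -> G (u, b) -> G (0, a - b).
  move=> Ga Gb; have := Glin (-1) _ _ _ _ Gb Ga.
  by rewrite scaleN1r addNr mulN1r addrC.
have p0 : p 0 = 0.
  have [M0 _] := Gp _ _ G0.
  have := pZ M0 (ltr0n R 2); rewrite scaler0 => h; lra.
have [_ h1] := Gp _ _ (Gsub _ _ Gr Gs).
have [_ h2] := Gp _ _ (Gsub _ _ Gs Gr).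
lra.
Qed.

(** The bounds on the value at [v] coming from [u - v] and from [u' + v] are
   compatible because [(u - v) + (u' + v) = u + u']; take the supremum of the
   lower ones. *)
Let extension_value G v : dominated_graph G -> M v ->
  exists c, forall u r, G (u, r) -> r + c <= p (u + v) /\ r - c <= p (u - v).
Proof.
move=> [G0 Gp Glin] Mv.
have MN w : M w -> M (- w).
  move=> Mw; have [M0 _] := Gp _ _ G0.
  by have := M_lin (-1) Mw M0; rewrite scaleN1r addr0.
have MD w z : M w -> M z -> M (w + z).
  by move=> Mw Mz; have := M_lin 1 Mw Mz; rewrite scale1r.
have key u r u' r' : G (u, r) -> G (u', r') ->
    r - p (u - v) <= p (u' + v) - r'.
  move=> Gu Gu'; have := Glin 1 _ _ _ _ Gu Gu'; rewrite scale1r mul1r => GD.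
  have [_ h1] := Gp _ _ GD.
  have [Mu _] := Gp _ _ Gu; have [Mu' _] := Gp _ _ Gu'.
  have h2 := pD (MD _ _ Mu (MN _ Mv)) (MD _ _ Mu' Mv).
  have : u - v + (u' + v) = u + u' by rewrite addrACA addNr addr0.
  move=> eqn; rewrite eqn in h2; lra.
pose S := [set x | exists u r, G (u, r) /\ x = r - p (u - v)].
have S0 : S !=set0 by exists (0 - p (0 - v)), 0, 0.
have Sub : has_ubound S.
  by exists (p (0 + v) - 0) => _ [u [r [Gu ->]]]; exact: key Gu G0.
exists (sup S) => u r Gu; split.
  suff : sup S <= p (u + v) - r by move=> ?; lra.
  by apply: ge_sup => // _ [u' [r' [Gu' ->]]]; exact: key.
suff : r - p (u - v) <= sup S by move=> ?; lra.
by apply: ub_le_sup => //; exists u, r.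
Qed.

Let extend G v : dominated_graph G -> M v ->
  exists H, [/\ dominated_graph H, G `<=` H & exists c, H (v, c)].
Proof.
move=> gG Mv; have [c hc] := extension_value gG Mv.
have [G0 Gp Glin] := gG.
have scG a u r : G (u, r) -> G (a *: u, a * r).
  by move=> Gu; have := Glin a _ _ _ _ Gu G0; rewrite !addr0.
pose H := [set y | exists u r a, G (u, r) /\ y = (u + a *: v, r + a * c)].
exists H; split.
- split.
  + by exists 0, 0, 0; rewrite scale0r mul0r !addr0.
  + move=> _ _ [u [r [a [Gu [-> ->]]]]].
    have [Mu ru] := Gp _ _ Gu.
    have Mw : M (u + a *: v) by rewrite addrC; exact: M_lin.
    split=> //; have [a0|a0|a0] := ltgtP a 0.
    * have na0 : 0 < - a by rewrite oppr_gt0.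
      have [_ h] := hc _ _ (scG (- a)^-1 _ _ Gu).
      have -> : u + a *: v = (- a) *: ((- a)^-1 *: u - v).
        by rewrite scalerBr scalerA divff ?gt_eqF// scale1r scaleNr opprK.
      have Mw' : M ((- a)^-1 *: u - v).
        rewrite -[_ - v]addr0 -addrA; apply: M_lin => //.
        have [M0 _] := Gp _ _ G0.
        by rewrite addr0; have := M_lin (-1) Mv M0; rewrite scaleN1r addr0.
      rewrite pZ//; move: h; rewrite -(ler_pM2l na0) mulrBr mulrA divff ?gt_eqF//.
      by rewrite mul1r mulNr opprK.
    * have [h _] := hc _ _ (scG a^-1 _ _ Gu).
      have -> : u + a *: v = a *: (a^-1 *: u + v).
        by rewrite scalerDr scalerA divff ?gt_eqF// scale1r.
      rewrite pZ//; last exact: M_lin.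
      by move: h; rewrite -(ler_pM2l a0) mulrDr mulrA divff ?gt_eqF// mul1r.
    * by rewrite a0 scale0r mul0r !addr0.
  + move=> b _ _ _ _ [u [r [a [Gu [-> ->]]]]] [u' [r' [a' [Gu' [-> ->]]]]].
    exists (b *: u + u'), (b * r + r'), (b * a + a'); split; first exact: Glin.
    congr (_, _); last by ring.
    by rewrite scalerDr scalerDl scalerA addrACA.
- by move=> [u r] Gu; exists u, r, 0; rewrite scale0r mul0r !addr0.
- by exists c, 0, 0, 1; split => //; rewrite scale1r mul1r !add0r.
Qed.

Theorem hahn_banach (K : set (E * R)) : dominated_graph K ->
  exists f : E -> R,
    [/\ forall a u v, M u -> M v -> f (a *: u + v) = a * f u + f v,
        forall u, M u -> f u <= p u &
        forall u r, K (u, r) -> f u = r].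
Proof.
move=> gK.
have [G [gG Gmax]] : exists G, dominated_graph (G `|` K) /\
    forall H, G `<` H -> ~ dominated_graph (H `|` K).
  (* [K] is added to every candidate so that the union of the empty chain is
     also a candidate. *)
  apply: (@Zorn_bigcup _ (fun G => dominated_graph (G `|` K))) => F FP Ftot.
  (* two points of the union of a chain lie in a common member *)
  have dir y z : (\bigcup_(X in F) X `|` K) y -> (\bigcup_(X in F) X `|` K) z ->
      exists H, [/\ dominated_graph H, H y, H z &
                    H `<=` \bigcup_(X in F) X `|` K].
    have up X : F X -> X `|` K `<=` \bigcup_(X in F) X `|` K.
      by move=> FX x [Xx|Kx]; [left; exists X|right].
    move=> [[X FX Xy]|Ky] [[Y FY Yz]|Kz].
    - have [XY|YX] := Ftot _ _ FX FY.
      + by exists (Y `|` K); split; [exact: FP|left; exact: XY|left|exact: up].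
      + by exists (X `|` K); split; [exact: FP|left|left; exact: YX|exact: up].
    - by exists (X `|` K); split; [exact: FP|left|right|exact: up].
    - by exists (Y `|` K); split; [exact: FP|right|left|exact: up].
    - by exists K; split => // x; right.
  split.
  - by right; case: gK.
  - by move=> u r h; have [H [[_ Hp _] Hu _ _]] := dir _ _ h h; exact: Hp.
  - move=> a u r v s hu hv; have [H [[_ _ Hl] Hu Hv sH]] := dir _ _ hu hv.
    by apply: sH; exact: Hl.
pose L := G `|` K.
have Ldom u : M u -> exists r, L (u, r).
  move=> Mu; have [H [gH LH [c Hc]]] := extend gG Mu.
  exists c; apply: contrapT => nLc; apply: (Gmax H).
    split; first by move=> x Gx; apply: LH; left.
    by move=> HG; apply: nLc; left; exact: HG.
  by have /setUidPl -> : K `<=` H by move=> x Kx; apply: LH; right.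
pose f u := xget 0 [set r | L (u, r)].
have fL u : M u -> L (u, f u).
  by move=> /Ldom[r Lr]; rewrite /f; case: xgetP => [y _ //|/(_ r)].
exists f; split.
- move=> a u v Mu Mv; apply: (dominated_graph_fun gG).
    by apply: fL; exact: M_lin.
  by case: gG => _ _; apply; exact: fL.
- by move=> u Mu; case: gG => _ /(_ _ _ (fL _ Mu))[].
- move=> u r Kr; have Lr : L (u, r) by right.
  apply: (dominated_graph_fun gG) Lr; apply: fL.
  by case: gK => _ /(_ _ _ Kr)[].
Qed.

End HahnBanach.

(** * Finitely additive set functions and charges *)

Section AdditiveCharges.
Local Open Scope ereal_scope.
Context d (T : measurableType d) (R : realType).
Implicit Types (nu : {additive_charge set T -> \bar R}).

Lemma additive_charge0 nu : nu set0 = 0.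
Proof.
have /[!big_ord0] ->// := @charge_semi_additive _ _ _ nu (fun=> set0) 0%N.
exact: trivIset_set0.
Qed.

Lemma additive_chargeU nu A B : measurable A -> measurable B ->
  A `&` B = set0 -> nu (A `|` B) = nu A + nu B.
Proof.
move=> mA mB AB; rewrite -bigsetU_bigcup2 (charge_semi_additive _ 2%N).
- by rewrite !(big_ord_recl, big_ord0)/= adde0.
- by move=> [|[|[]]]//=.
- by rewrite -trivIset_bigcup2.
- by rewrite bigsetU_bigcup2; exact: measurableU.
Qed.

(** Tails of a disjoint family have vanishing [m]-measure, so domination by a
    finite measure upgrades finite additivity to countable additivity. *)
Lemma dominated_additive_charge
    (m : {finite_measure set T -> \bar R}) (nu : set T -> \bar R) :
  nu set0 = 0 ->
  (forall A B, measurable A -> measurable B -> A `&` B = set0 ->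
     nu (A `|` B) = nu A + nu B) ->
  (forall E, measurable E -> `|nu E| <= m E) ->
  exists c : {charge set T -> \bar R}, c = nu :> (set T -> \bar R).
Proof.
move=> nu0 nuU num.
have nufin E : measurable E -> nu E \is a fin_num.
  move=> mE; rewrite -abse_fin_num ge0_fin_numE//.
  by rewrite (le_lt_trans (num _ mE))// ltey_eq fin_num_measure.
suff sig : semi_sigma_additive nu.
  pose c : {charge set T -> \bar R} :=
    HB.pack nu (isCharge.Build _ _ _ nu nu0 nufin sig).
  by exists c.
move=> F mF tF mUF.
pose U n := \big[setU/set0]_(i < n) F i.
have mU n : measurable (U n) by exact: bigsetU_measurable.
have UF n : U n `&` F n = set0.
  rewrite /U -bigcup_mkord; apply/seteqP; split => // x [[i /= ltin Fix] Fnx].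
  have ne : i != n by rewrite neq_ltn ltin.
  have /trivIsetP/(_ i n Logic.I Logic.I ne) FiFn := tF.
  by have : (F i `&` F n) x by []; rewrite FiFn.
have sumU (f : set T -> \bar R) : f set0 = 0 ->
    (forall A B, measurable A -> measurable B -> A `&` B = set0 ->
       f (A `|` B) = f A + f B) ->
    forall n, \sum_(0 <= i < n) f (F i) = f (U n).
  move=> f0 fU; elim=> [|n IH]; first by rewrite big_geq// /U big_ord0.
  rewrite big_nat_recr//= IH /U big_ord_recr/= fU//;
    [exact: mU|exact: UF].
have mUE : forall n, \sum_(0 <= i < n) m (F i) = m (U n).
  by apply: (sumU m (measure0 m)) => A B mA mB AB; rewrite measureU.
have nuUE := sumU _ nu0 nuU.
have cvm := measure_semi_sigma_additive F mF tF mUF : _ --> m _.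
set S := \bigcup_n F n in mUF cvm *.
have bnd n : nu S - (m S - m (U n)) <= nu (U n) <= nu S + (m S - m (U n)).
  have US : S = U n `|` (S `\` U n).
    rewrite setDUK// /U -bigcup_mkord => x [i _ Fx]; by exists i.
  have mD : measurable (S `\` U n) by exact: measurableD.
  have nuS : nu S = nu (U n) + nu (S `\` U n).
    by rewrite -nuU ?setDIK// -US.
  have mS : m S = m (U n) + m (S `\` U n) by rewrite -measureU ?setDIK// -US.
  have := num _ mD; rewrite nuS mS.
  rewrite -(fineK (nufin _ mD)) -(fineK (nufin _ (mU n))).
  rewrite -(fineK (fin_num_measure m _ mD)) -(fineK (fin_num_measure m _ (mU n))).
  rewrite -?EFinD -?EFinB -?EFinD -?EFinB !lee_fin => /ler_normlP[h1 h2].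
  by apply/andP; split; lra.
have tail : (fun n => m S - m (U n)) @ \oo --> 0.
  rewrite -[X in _ --> X](subee (fin_num_measure m _ mUF)).
  apply: cvgeB; first by rewrite fin_num_adde_defr// fin_num_measure.
    exact: cvg_cst.
  by rewrite -(funext mUE).
under eq_fun do rewrite nuUE.
apply: (@squeeze_cvge _ _ _ _ (fun n => nu S - (m S - m (U n))) _
   (fun n => nu S + (m S - m (U n)))).
- exact: nearW.
- rewrite -[X in _ --> X]sube0; apply: cvgeB => //; last exact: cvg_cst.
  by rewrite fin_num_adde_defr// nufin.
- rewrite -[X in _ --> X]adde0; apply: cvgeD => //; last exact: cvg_cst.
  by rewrite fin_num_adde_defr// nufin.
Qed.

End AdditiveCharges.

(** Reduce a goal on values of finite set functions to one on reals: name the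
    real value of [t], where [t] is known to be finite. *)
Ltac real_value t :=
  let r := fresh "r" in
  have [r ->] : exists r, t = EFin r;
  [by exists (fine t); rewrite fineK//; apply: fin_num_measure; auto|].

(** * Meets of charges *)

Section Meet.
Local Open Scope ereal_scope.
Context d (T : measurableType d) (R : realType).
Implicit Types (a b c : {charge set T -> \bar R}) (E G N : set T).

Lemma chargeID a E N : measurable E -> measurable N ->
  a E = a (E `&` N) + a (E `\` N).
Proof. by move=> mE mN; rewrite addeC -chargeDI. Qed.

(** The optimal partition is a Hahn decomposition of [a - b]: take the smaller
    measure on each part. *)
Lemma sf_meetE a b : exists2 N, measurable N &
  forall E, measurable E -> sf_meet a b E = a (E `&` N) + b (E `\` N).
Proof.
have [P [N [[mP posP] [mN negN] PNT PN0]]] :=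
  Hahn_decomposition (cadd a (copp b)).
exists N => // E mE.
have mEN : measurable (E `&` N) by exact: measurableI.
have mED : measurable (E `\` N) by exact: measurableD.
apply/eqP; rewrite eq_le; apply/andP; split.
  apply: ereal_inf_lbound; exists (E `&` N), (E `\` N); split => //.
  - by rewrite setDE setIACA setICr setI0.
  - by rewrite setDE -setIUr setUv setIT.
apply/ereal_infP => _ [X1 [X2 [mX1 mX2 X120 X12E ->]]].
have mI X : measurable X -> measurable (X `&` N) by move=> ?; exact: measurableI.
have mD X : measurable X -> measurable (X `\` N) by move=> ?; exact: measurableD.
have aE : a (E `&` N) = a (X1 `&` N) + a (X2 `&` N).
  rewrite -chargeU; [|exact: mI|exact: mI|].
    by rewrite -setIUl X12E.
  by rewrite setIACA X120 set0I.
have bE : b (E `\` N) = b (X1 `\` N) + b (X2 `\` N).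
  rewrite -chargeU; [|exact: mD|exact: mD|].
    by rewrite -setDUl X12E.
  by rewrite !setDE setIACA X120 set0I.
have ab : a (X2 `&` N) <= b (X2 `&` N).
  have m1 := mI _ mX2.
  have : a (X2 `&` N) - b (X2 `&` N) <= 0 by exact: negN.
  real_value (a (X2 `&` N)); real_value (b (X2 `&` N)).
  by rewrite -EFinB !lee_fin subr_le0.
have ba : b (X1 `\` N) <= a (X1 `\` N).
  have DP : X1 `\` N `<=` P.
    move=> x [_ Nx]; have : [set: T] x by [].
    by rewrite -PNT => -[].
  have m1 := mD _ mX1.
  have : 0 <= a (X1 `\` N) - b (X1 `\` N) by exact: posP.
  real_value (a (X1 `\` N)); real_value (b (X1 `\` N)).
  by rewrite -EFinB !lee_fin subr_ge0.
rewrite aE bE (chargeID a mX1 mN) (chargeID b mX2 mN).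
rewrite addeACA; apply: leeD; exact: leeD.
Qed.

Lemma sf_meet_charge a b : exists m : {charge set T -> \bar R},
  sf_eq m (sf_meet a b).
Proof.
have [N mN abE] := sf_meetE a b.
exists (cadd (crestr a mN) (crestr b (measurableC mN))) => E mE.
by rewrite abE.
Qed.

Lemma sf_meet_lel a b : sf_le (sf_meet a b) a.
Proof.
move=> E mE; apply: ereal_inf_lbound; exists E, set0; split => //.
- by rewrite setI0.
- by rewrite setU0.
- by rewrite charge0 adde0.
Qed.

Lemma sf_meet_ler a b : sf_le (sf_meet a b) b.
Proof.
move=> E mE; apply: ereal_inf_lbound; exists set0, E; split => //.
- by rewrite set0I.
- by rewrite set0U.
- by rewrite charge0 add0e.
Qed.

Lemma sf_meet_glb a b c : sf_le c a -> sf_le c b -> sf_le c (sf_meet a b).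
Proof.
move=> ca cb E _; apply/ereal_infP => _ [X [Y [mX mY XY0 <- ->]]].
by rewrite chargeU//; apply: leeD; [exact: ca|exact: cb].
Qed.

Lemma nonneg_charge_le a E G : sf_le (cst 0) a -> measurable E -> measurable G ->
  E `<=` G -> a E <= a G.
Proof.
move=> a0 mE mG EG; rewrite (chargeID a mG mE) (setIidr EG).
by rewrite leeDl//; apply: a0; exact: measurableD.
Qed.

Lemma nonneg_charge_measure a : sf_le (cst 0) a ->
  exists m : {finite_measure set T -> \bar R}, sf_eq m a.
Proof.
move=> a0; have PN : hahn_decomposition a setT set0.
  split; [|exact: negative_set0|exact: setU0|exact: setI0].
  by split => // E mE _; exact: a0.
exists (jordan_pos PN) => E mE.
rewrite [LHS](_ : _ = if E \in measurable then a (E `&` setT) else 0)//.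
by rewrite mem_set// setIT.
Qed.

Lemma sf_meet_eq (a a' b b' : set T -> \bar R) :
  sf_eq a a' -> sf_eq b b' -> sf_meet a b = sf_meet a' b'.
Proof.
move=> aa bb; apply/funext => E; congr ereal_inf; apply/seteqP; split=> r.
  by move=> [X [Y [mX mY XY XYE ->]]]; exists X, Y; split=> //; rewrite aa ?bb.
by move=> [X [Y [mX mY XY XYE ->]]]; exists X, Y; split=> //; rewrite aa ?bb.
Qed.

Definition sf_singular (a b : set T -> \bar R) : Prop :=
  exists G, [/\ measurable G, a G = 0 & b (~` G) = 0].

(** At a Hahn decomposition of [a - b] the meet is [a] on one part and [b] on
    the other, so it vanishes only if each measure is zero on its part. *)
Lemma sf_meet_eq0P a b : sf_le (cst 0) a -> sf_le (cst 0) b ->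
  (sf_eq (sf_meet a b) (cst 0) <-> sf_singular a b).
Proof.
move=> a0 b0; split.
  have [N mN abE] := sf_meetE a b => ab0.
  exists N; split=> //.
  + have := abE _ mN; rewrite ab0// setIid setDv charge0 adde0/= => <-//.
  + have := abE _ (measurableC mN).
    rewrite ab0; last exact: measurableC.
    by rewrite setICl charge0 add0e setDE setIid /= => <-.
move=> [G [mG aG bG]] E mE; apply/eqP; rewrite eq_le; apply/andP; split.
  have mI : measurable (E `&` G) by exact: measurableI.
  have mD : measurable (E `\` G) by exact: measurableD.
  apply: (@le_trans _ _ (a (E `&` G) + b (E `\` G))).
    apply: ereal_inf_lbound; exists (E `&` G), (E `\` G); split => //.
    + by rewrite setDE setIACA setICr setI0.
    + by rewrite setDE -setIUr setUv setIT.
  rewrite -[leRHS]adde0; apply: leeD.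
    by rewrite -aG; apply: nonneg_charge_le => //; exact: subIsetr.
  rewrite -bG; apply: nonneg_charge_le => //; exact: measurableC.
exact: (@sf_meet_glb a b czero).
Qed.

End Meet.

(** * Transposes and boundaries *)

Section Pushforward.
Local Open Scope ereal_scope.
Context d1 d2 (T1 : measurableType d1) (T2 : measurableType d2) (R : realType).

Lemma pushforward_charge (nu : {charge set T1 -> \bar R}) (f : T1 -> T2) :
  measurable_fun setT f ->
  exists c : {charge set T2 -> \bar R}, forall E, c E = nu (f @^-1` E).
Proof.
move=> mf.
by exists (measure_function_pushforward__canonical__charge_Charge nu mf).
Qed.

End Pushforward.

Section Transpose.
Local Open Scope ereal_scope.
Context d (J : measurableType d) (R : realType).
Implicit Types (nu : {charge set (J * J)%type -> \bar R}).

Lemma transpose_charge nu :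
  exists c : {charge set (J * J)%type -> \bar R}, forall E, c E = transpose nu E.
Proof.
by have [c cE] := pushforward_charge nu (@measurable_swap _ _ J J); exists c.
Qed.

Lemma boundaryE nu X : measurable X ->
  boundary nu X = nu (X `*` setT) - nu (setT `*` X).
Proof.
move=> mX; have mCX := measurableC mX.
have mXX : measurable (X `*` X) by exact: measurableX.
have mXC : measurable (X `*` ~` X) by exact: measurableX.
have mCXX : measurable (~` X `*` X) by exact: measurableX.
have -> : X `*` setT = X `*` X `|` X `*` ~` X.
  by apply/seteqP; split=> -[x y] /=; have := pselect (X y); tauto.
have -> : setT `*` X = X `*` X `|` ~` X `*` X.
  by apply/seteqP; split=> -[x y] /=; have := pselect (X x); tauto.
rewrite !chargeU//; try by apply/seteqP; split=> -[x y] /=; tauto.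
rewrite /boundary.
real_value (nu (X `*` X)); real_value (nu (X `*` ~` X)).
real_value (nu (~` X `*` X)).
by rewrite -?EFinD -?EFinB -?EFinD; congr EFin; ring.
Qed.

Lemma boundary_charge nu :
  exists c : {charge set J -> \bar R}, sf_eq c (boundary nu).
Proof.
have [c1 c1E] := pushforward_charge nu measurable_fst.
have [c2 c2E] := pushforward_charge nu measurable_snd.
exists (cadd c1 (copp c2)) => X mX; rewrite boundaryE//.
rewrite [LHS](_ : _ = c1 X - c2 X)// c1E c2E.
by congr (nu _ - nu _); apply/seteqP; split => -[x y] /=; tauto.
Qed.

End Transpose.

(** * Charges with prescribed boundary *)

Section Simple.
Context d (T : measurableType d) (R : realType).
Implicit Types (f g : T -> R^o) (m : {finite_measure set T -> \bar R}).

(** The codomain is the module [R^o] rather than [R]: simple functions are to be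
    vectors of a left module. *)
Definition simple : set (T -> R^o) := [set f |
  measurable_fun setT (f : T -> R) /\ exists s : seq R, forall x, f x \in s].

Lemma simple_lin (a : R) f g : simple f -> simple g -> simple (a *: f + g).
Proof.
move=> [mf [s fs]] [mg [t gt]]; split.
  by apply: measurable_funD => //; exact: measurable_funM.
exists [seq a * x + y | x <- s, y <- t] => x.
by apply/allpairsP; exists (f x, g x); rewrite fs gt.
Qed.

Lemma simple_norm f : simple f -> simple (fun x => `|f x|).
Proof.
move=> [mf [s fs]]; split; first exact: measurableT_comp.
by exists (map Num.norm s) => x; apply: map_f.
Qed.

Lemma simple_indic (A : set T) : measurable A -> simple \1_A.
Proof.
move=> mA; split; first exact: measurable_indic.
by exists [:: 0; 1] => x; rewrite indicE; case: (x \in A); rewrite !inE eqxx ?orbT.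
Qed.

Lemma simple_cst (c : R) : simple (cst c).
Proof. by split => //; exists [:: c] => x; rewrite inE. Qed.

Lemma simple_integrable m f : simple f -> m.-integrable setT (EFin \o f).
Proof.
move=> [mf [s fs]]; apply: measurable_bounded_integrable => //.
  by rewrite ltey_eq fin_num_measure.
exists (\sum_(y <- s) `|y|); split; first exact: num_real.
move=> M sM x _; apply: le_trans (ltW sM) => /=.
rewrite (big_rem (f x)) ?fs//= lerDl.
by apply: sumr_ge0 => y _.
Qed.

Definition sint m f : R := \int[m]_x (f x : R).

Lemma sint_lin m a f g : simple f -> simple g ->
  sint m (a *: f + g) = a * sint m f + sint m g.
Proof.
move=> sf sg; rewrite /sint RintegralD//; last 2 first.
- have := simple_integrable m (simple_lin a sf (simple_cst 0)).
  by apply: eq_integrable => // x _ /=; rewrite addr0.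
- exact: simple_integrable.
by rewrite RintegralZl//; exact: simple_integrable.
Qed.

Lemma sint_indic m (A : set T) : measurable A -> sint m \1_A = fine (m A).
Proof. by move=> mA; rewrite /sint /Rintegral integral_indic// setIT. Qed.

Lemma le_sint m f g : simple f -> simple g -> (forall x, f x <= g x) ->
  sint m f <= sint m g.
Proof.
by move=> sf sg fg; apply: le_Rintegral => //; exact: simple_integrable.
Qed.

Lemma sint_cst m (c : R) : sint m (cst c) = c * fine (m setT).
Proof. exact: Rintegral_cst. Qed.

End Simple.
Arguments simple {d T R}.

Section Coarea.
Context d (J : measurableType d) (R : realType).
Variables (m : {finite_measure set (J * J)%type -> \bar R}).
Variable delta : {charge set J -> \bar R}.
Variables (P N : set J) (PN : hahn_decomposition delta P N).
Hypothesis delta_cut : forall X, measurable X ->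
  (delta X <= m (X `*` ~` X) + m (~` X `*` X))%E.
Hypothesis deltaT : delta setT = 0.
Implicit Types f g : J -> R^o.

Definition coboundary f : (J * J)%type -> R^o := fun z => f z.1 - f z.2.

Lemma coboundary_lin a f g :
  coboundary (a *: f + g) = a *: coboundary f + coboundary g.
Proof.
by apply/funext => z; rewrite /coboundary !fctE /GRing.scale /=; ring.
Qed.

Lemma simple_coboundary f : simple f -> simple (coboundary f).
Proof.
move=> [mf [s fs]]; split.
  apply: measurable_funB; first exact: (measurableT_comp mf measurable_fst).
  exact: (measurableT_comp mf measurable_snd).
exists [seq x - y | x <- s, y <- s] => z.
by apply/allpairsP; exists (f z.1, f z.2); rewrite !fs.
Qed.

(** The integral of a simple function against the signed measure [delta]. *)
Definition charge_int f : R :=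
  sint (jordan_pos PN) f - sint (jordan_neg PN) f.

Lemma charge_int_lin a f g : simple f -> simple g ->
  charge_int (a *: f + g) = a * charge_int f + charge_int g.
Proof. by move=> sf sg; rewrite /charge_int !sint_lin//; ring. Qed.

Lemma charge_int_indic A : measurable A -> charge_int \1_A = fine (delta A).
Proof.
move=> mA; rewrite /charge_int !sint_indic// (jordan_decomp PN mA).
rewrite -fineB ?fin_num_measure//; congr fine.
rewrite [RHS](_ : _ = jordan_pos PN A + (-1)%:E * jordan_neg PN A)%E//.
by rewrite mulN1e.
Qed.

Lemma charge_int_cst c : charge_int (cst c) = 0.
Proof.
have := charge_int_indic (@measurableT _ J); rewrite deltaT /charge_int.
by rewrite !sint_indic// !sint_cst -mulrBr => ->; rewrite mulr0.
Qed.

Lemma charge_int_indic_le A : measurable A ->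
  charge_int \1_A <= sint m (fun z => `|coboundary \1_A z|).
Proof.
move=> mA; have mCA := measurableC mA.
have m1 : measurable (A `*` ~` A) by exact: measurableX.
have m2 : measurable (~` A `*` A) by exact: measurableX.
have -> : (fun z => `|coboundary \1_A z|) =
    1 *: (\1_(A `*` ~` A) : (J * J)%type -> R^o) + \1_(~` A `*` A).
  apply/funext => -[x y]; rewrite scale1r fctE /coboundary/= !indicE.
  rewrite !in_setX !in_setC /=.
  case: (x \in A); case: (y \in A); rewrite /= ?subr0 ?sub0r ?subrr ?normrN;
  by rewrite ?normr0 ?normr1 ?addr0 ?add0r.
rewrite sint_lin ?mul1r; [|exact: simple_indic..].
rewrite !sint_indic// charge_int_indic// -fineD ?fin_num_measure//.
by apply: fine_le; rewrite ?fin_numD ?fin_num_measure//; exact: delta_cut.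
Qed.

(** Peel off the top level of [f]: if its values lie in the nonincreasing list
    [M :: c :: s] and [A = {f > c}], then [f = (M - c) 1_A + min f c] and
    [|coboundary f| = (M - c) |coboundary 1_A| + |coboundary (min f c)|], as the
    two coboundaries never have opposite signs.  The cut inequality applies to
    [A], and induction to [min f c], whose values lie in [c :: s]. *)
Lemma coarea f : simple f ->
  charge_int f <= sint m (fun z => `|coboundary f z|).
Proof.
move=> [mf [s0 fs0]].
have [s ss fs] : exists2 s : seq R, sorted >=%R s & forall x, f x \in s.
  exists (sort >=%R s0) => [|x]; last by rewrite mem_sort.
  by apply: sort_sorted => x y; exact: ge_total.
have ge0 g : 0 <= sint m (fun z => `|coboundary g z|) by exact: Rintegral_ge0.
elim: s f mf ss fs {s0 fs0} => [|M s IH] f mf ss fs.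
  have -> : f = cst 0 by apply/funext => x; have := fs x.
  by rewrite charge_int_cst.
case: s => [|c s] in IH ss fs *.
  have -> : f = cst M by apply/funext => x; have := fs x; rewrite inE => /eqP.
  by rewrite charge_int_cst.
have /= /andP[cM scs] := ss.
have cs y : y \in c :: s -> y <= c.
  have /(order_path_min (rev_trans le_trans))/allP h := scs.
  by rewrite inE => /predU1P[->//|/h].
pose A := [set x | c < f x].
have mA : measurable A.
  rewrite -[A]setTI /A -preimage_itvoy.
  by apply: mf => //; exact: measurable_itv.
pose g : J -> R^o := fun x => Num.min (f x) c.
have mg : measurable_fun setT (g : J -> R) by exact: measurable_minr.
have fA x : A x -> f x = M.
  move=> Ax; have := fs x; rewrite inE => /predU1P[//|/cs].
  by rewrite leNgt Ax.
have gs x : g x \in c :: s.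
  rewrite /g; have [fc|cf] := leP (f x) c; last by rewrite mem_head.
  have := fs x; rewrite inE => /predU1P[fM|//].
  by have -> : f x = c; [apply/eqP; rewrite eq_le fc fM cM|rewrite mem_head].
have sg : simple g by split => //; exists (c :: s).
have sA : simple (\1_A : J -> R^o) by exact: simple_indic.
have nA x : f x <= c -> x \notin A.
  by move=> fc; apply/negP; rewrite inE /A /= ltNge fc.
have fE : f = (M - c) *: (\1_A : J -> R^o) + g.
  apply/funext => x; rewrite fctE -[X in _ = X + _]/((M - c) * \1_A x) indicE /g.
  have [fc|cf] := leP (f x) c.
    by rewrite (negbTE (nA _ fc)) /= mulr0 add0r.
  by rewrite mem_set// fA// mulr1 subrK.
have nE : (fun z => `|coboundary f z|) =
    (M - c) *: ((fun z => `|coboundary \1_A z|) : (J * J)%type -> R^o) +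
    (fun z => `|coboundary g z|).
  apply/funext => -[x y]; rewrite fctE.
  rewrite -[X in _ = X + _]/((M - c) * `|coboundary \1_A (x, y)|).
  rewrite /coboundary /= !indicE.
  have case_in u : (u \in A) /\ f u = M /\ g u = c \/
      (u \notin A) /\ f u = g u /\ g u <= c.
    rewrite /g; have [fc|cf] := leP (f u) c.
      by right; rewrite nA.
    by left; rewrite mem_set// fA.
  have [[-> [-> ->]]|[/negbTE -> [-> gx]]] := case_in x;
  have [[-> [-> ->]]|[/negbTE -> [-> gy]]] := case_in y.
  - by rewrite !subrr normr0 mulr0 add0r.
  - rewrite subr0 normr1 !ger0_norm ?subr_ge0//; last exact: le_trans gy cM.
    by lra.
  - rewrite sub0r normrN1 !ler0_norm ?subr_le0//; last exact: le_trans gx cM.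
    by lra.
  - by rewrite subrr normr0 mulr0 add0r.
rewrite nE {1}fE charge_int_lin// sint_lin; last 2 first.
- by apply: simple_norm; exact: simple_coboundary.
- by apply: simple_norm; exact: simple_coboundary.
by apply: lerD; [rewrite ler_wpM2l ?subr_ge0//; exact: charge_int_indic_le
                |exact: IH].
Qed.

End Coarea.

Section Lifting.
Context d (J : measurableType d) (R : realType).

(** The graph [K] is the functional that the required boundary forces on
    coboundaries, since [int (f x - f y) d nu = int f d (boundary nu)]. *)
Theorem boundary_surjective (m : {finite_measure set (J * J)%type -> \bar R})
    (delta : {charge set J -> \bar R}) :
  (forall X, measurable X ->
    (delta X <= m (X `*` ~` X) + m (~` X `*` X))%E) ->
  delta setT = 0 ->
  exists nu : {charge set (J * J)%type -> \bar R},
    (forall E, measurable E -> (`|nu E| <= m E)%E) /\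
    sf_eq (boundary nu) delta.
Proof.
move=> dcut dT.
have [P [N PN]] := Hahn_decomposition delta.
pose p (g : (J * J)%type -> R^o) := sint m (fun z => `|g z|).
pose K := [set y : ((J * J)%type -> R^o) * R |
  exists2 f : J -> R^o, simple f & y = (coboundary f, charge_int PN f)].
have pE (g : (J * J)%type -> R^o) : simple g -> simple (fun z => `|g z| : R^o).
  exact: simple_norm.
have pD (u v : (J * J)%type -> R^o) : simple u -> simple v -> p (u + v) <= p u + p v.
  move=> su sv; rewrite -[p u]mul1r -sint_lin; [|exact: pE..].
  have suv : simple (u + v) by rewrite -[u]scale1r; exact: simple_lin.
  apply: le_sint; [exact: pE| |].
    by apply: simple_lin; exact: pE.
  by move=> z; rewrite scale1r fctE; exact: ler_normD.
have pZ (a : R) (u : (J * J)%type -> R^o) : simple u -> 0 < a -> p (a *: u) = a * p u.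
  move=> su a0; rewrite /p /sint -RintegralZl//; last first.
    exact/simple_integrable/pE.
  by apply: eq_Rintegral => z _; rewrite normrZ gtr0_norm.
have gK : dominated_graph (simple : set ((J * J)%type -> R^o)) p K.
  split.
  - exists (cst 0); first exact: simple_cst.
    congr (_, _); first by apply/funext => z; rewrite /coboundary subrr.
    exact/esym/(charge_int_cst PN dT 0).
  - move=> _ _ [f sf [-> ->]]; split; first exact: simple_coboundary.
    exact: coarea.
  - move=> a _ _ _ _ [f sf [-> ->]] [g sg [-> ->]].
    exists (a *: f + g); first exact: simple_lin.
    by rewrite coboundary_lin charge_int_lin.
have [F [Flin Fp FK]] := hahn_banach (@simple_lin _ _ _) pD pZ gK.
have F0 : F 0 = 0 by apply: FK; case: gK.
have s0 : simple (0 : (J * J)%type -> R^o) by case: gK => K0 /(_ _ _ K0)[].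
have FD u v : simple u -> simple v -> F (u + v) = F u + F v.
  by move=> su sv; rewrite -[u]scale1r Flin// scale1r mul1r.
have FN u : simple u -> F (- u) = - F u.
  by move=> su; rewrite -[- u]addr0 -scaleN1r Flin// F0 addr0 mulN1r.
have SN (u : (J * J)%type -> R^o) : simple u -> simple (- u).
  by move=> su; rewrite -[- u]addr0 -scaleN1r; exact: simple_lin.
have sI A : measurable A -> simple (\1_A : (J * J)%type -> R^o).
  exact: simple_indic.
pose nu (A : set (J * J)%type) : \bar R := (F \1_A)%:E.
have nu_dom A : measurable A -> (`|nu A| <= m A)%E.
  move=> mA; have pA : p \1_A = fine (m A).
    rewrite -sint_indic// /p; congr sint; apply/funext => z.
    by rewrite ger0_norm.
  have pNA : p (- \1_A) = p \1_A.
    by rewrite /p; congr sint; apply/funext => z; rewrite fctE normrN.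
  rewrite -(fineK (fin_num_measure m _ mA)) -pA lee_fin ler_norml.
  rewrite lerNl -FN; last exact: sI.
  by rewrite -{1}pNA !Fp//; [exact: sI|apply: SN; exact: sI].
have [c cE] : exists c : {charge set (J * J)%type -> \bar R},
    c = nu :> (set (J * J)%type -> \bar R).
  apply: (dominated_additive_charge (m := m)) => //.
  - by rewrite /nu indic0 F0.
  - move=> A B mA mB AB; rewrite /nu -EFinD -FD; [|exact: sI..].
    congr (F _)%:E; apply/funext => z; rewrite fctE !indicE in_setU.
    case: (boolP (z \in A)) => zA; case: (boolP (z \in B)) => zB /=.
    + have : (A `&` B) z by split; exact: set_mem.
      by rewrite AB.
    + by rewrite addr0.
    + by rewrite add0r.
    + by rewrite addr0.
exists c; split; first by rewrite cE.
move=> X mX; rewrite boundaryE// cE /nu -EFinB.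
have m1 : measurable (X `*` [set: J]) by exact: measurableX.
have m2 : measurable ([set: J] `*` X) by exact: measurableX.
rewrite -FN; last exact: sI.
rewrite -FD; [|exact: sI|by apply: SN; exact: sI].
rewrite (FK _ (charge_int PN \1_X)).
  by rewrite charge_int_indic// fineK// fin_num_measure.
exists \1_X; first exact: simple_indic.
congr (_, _); apply/funext => -[x y].
rewrite fctE -[X in _ + X]/(- (\1_([set: J] `*` X) (x, y))).
by rewrite /coboundary /= !indicE !in_setX !in_setT andbT.
Qed.

End Lifting.

Section Flows.
Local Open Scope ereal_scope.
Context d (J : measurableType d) (R : realType).
Implicit Types (nu eta gamma : {charge set (J * J)%type -> \bar R}).
Implicit Types (X : set J) (E : set (J * J)%type).

Lemma measurable_XC X : measurable X -> measurable (X `*` ~` X).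
Proof. by move=> mX; apply: measurableX => //; exact: measurableC. Qed.

Lemma measurable_CX X : measurable X -> measurable (~` X `*` X).
Proof. by move=> mX; apply: measurableX => //; exact: measurableC. Qed.

#[local] Hint Resolve measurable_XC measurable_CX : core.

Lemma boundary_fin nu X : measurable X -> boundary nu X \is a fin_num.
Proof.
move=> mX; rewrite /boundary fin_numB; apply/andP.
by split; apply: fin_num_measure; auto.
Qed.

Lemma boundaryC nu X : measurable X -> boundary nu (~` X) = - boundary nu X.
Proof.
move=> mX; rewrite /boundary setCK.
real_value (nu (X `*` ~` X)).
real_value (nu (~` X `*` X)).
by rewrite -!EFinB -EFinN opprB.
Qed.

Lemma boundaryT nu : boundary nu setT = 0.
Proof. by rewrite /boundary setCT setX0 set0X !charge0 sube0. Qed.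

(** [delta] is dominated by the sum of the marginals of [eta], which makes it
    countably additive; the lower bound comes from the upper bound on the
    complement, since [delta (~` X) = - delta X] and cuts are symmetric. *)
Lemma cut_lift eta (delta : {additive_charge set J -> \bar R}) :
  sf_le (cst 0) eta -> sf_le delta (cut_function (\- eta) eta) ->
  delta setT = 0 ->
  exists nu, [/\ sf_le nu eta, sf_le (\- nu) eta & sf_eq (boundary nu) delta].
Proof.
move=> eta0 dcut dT.
have [m mE] := nonneg_charge_measure eta0.
have dcut' X : measurable X ->
    delta X <= eta (X `*` ~` X) + eta (~` X `*` X).
  by move=> mX; have := dcut _ mX; rewrite /cut_function oppeK.
have [c1 c1E] := pushforward_charge eta measurable_fst.
have [c2 c2E] := pushforward_charge eta measurable_snd.
have c1X X : c1 X = eta (X `*` setT).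
  by rewrite c1E; congr (eta _); apply/seteqP; split=> -[x y] /=; tauto.
have c2X X : c2 X = eta (setT `*` X).
  by rewrite c2E; congr (eta _); apply/seteqP; split=> -[x y] /=; tauto.
have [n nE] : exists n : {finite_measure set J -> \bar R}, sf_eq n (cadd c1 c2).
  apply: nonneg_charge_measure => X mX; rewrite [leRHS](_ : _ = c1 X + c2 X)//.
  by rewrite c1X c2X; apply: adde_ge0; apply: eta0; exact: measurableX.
have dn X : measurable X -> delta X <= n X.
  move=> mX; rewrite nE// [leRHS](_ : _ = c1 X + c2 X)// c1X c2X.
  apply: le_trans (dcut' _ mX) _; apply: leeD.
    apply: nonneg_charge_le => //; [exact: measurable_XC|exact: measurableX|].
    by move=> [x y] /= [].
  apply: nonneg_charge_le => //; [exact: measurable_CX|exact: measurableX|].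
  by move=> [x y] /= [].
have dC X : measurable X -> delta (~` X) = - delta X.
  move=> mX; have mCX := measurableC mX.
  have := additive_chargeU delta mX mCX (setICr X).
  rewrite setUv dT; real_value (delta X); real_value (delta (~` X)).
  by rewrite -EFinD -EFinN => -[h]; congr EFin; lra.
have dcutC X : measurable X -> - delta X <= n X.
  move=> mX; have mCX := measurableC mX.
  rewrite -dC//; apply: le_trans (dcut' _ mCX) _; rewrite setCK addeC.
  rewrite nE// [leRHS](_ : _ = c1 X + c2 X)// c1X c2X; apply: leeD.
    apply: nonneg_charge_le => //; [exact: measurable_XC|exact: measurableX|].
    by move=> [x y] /= [].
  apply: nonneg_charge_le => //; [exact: measurable_CX|exact: measurableX|].
  by move=> [x y] /= [].
have [c cE] : exists c : {charge set J -> \bar R},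
    c = delta :> (set J -> \bar R).
  apply: (dominated_additive_charge (m := n)).
  - exact: additive_charge0.
  - exact: additive_chargeU.
  - move=> X mX; have := dcutC _ mX; have := dn _ mX.
    real_value (delta X); real_value (n X).
    by rewrite -EFinN !lee_fin ler_norml lerNl => -> ->.
have [||nu [num nuc]] := @boundary_surjective _ _ _ m c.
- by move=> X mX; rewrite cE !mE//; auto.
- by rewrite cE.
exists nu; split; last by move=> X mX; rewrite nuc// cE.
- by move=> E hE; rewrite -mE//; apply: le_trans (num _ hE); exact: lee_abs.
- move=> E hE; rewrite -mE//; apply: le_trans (num _ hE).
  by rewrite -abseN; exact: lee_abs.
Qed.

(** * Circulations *)

Lemma measurable_transpose E : measurable E ->
  measurable [set xy : J * J | E (xy.2, xy.1)].
Proof.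
move=> mE; have := measurable_swap; move=> /(_ _ _ J J measurableT _ mE).
by rewrite setTI.
Qed.

#[local] Hint Resolve measurable_transpose : core.

Lemma transposeK (mu : set (J * J)%type -> \bar R) :
  transpose (transpose mu) = mu.
Proof.
by apply/funext => E; rewrite /transpose; congr mu; apply/funext => -[].
Qed.

Lemma transpose_sf_le (mu nu : set (J * J)%type -> \bar R) :
  sf_le mu nu -> sf_le (transpose mu) (transpose nu).
Proof. by move=> h E mE; apply: h; auto. Qed.

Lemma transposeX (mu : set (J * J)%type -> \bar R) X Y :
  transpose mu (X `*` Y) = mu (Y `*` X).
Proof.
by rewrite /transpose; congr mu; apply/seteqP; split=> -[x y] /=; tauto.
Qed.

Lemma circulationP nu : circulation nu <-> sf_eq (boundary nu) (cst 0).
Proof.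
split=> h X mX.
  rewrite boundaryE// h//= subee//.
  by apply: fin_num_measure; exact: measurableX.
have := h _ mX; rewrite boundaryE//.
have m1 : measurable (X `*` [set: J]) by exact: measurableX.
have m2 : measurable ([set: J] `*` X) by exact: measurableX.
real_value (nu (X `*` setT)); real_value (nu (setT `*` X)).
by rewrite -EFinB => -[h']; congr EFin; lra.
Qed.

Lemma reducedP gamma : sf_le (cst 0) gamma ->
  (reduced gamma <-> sf_singular gamma (transpose gamma)).
Proof.
move=> g0; have [gt gtE] := transpose_charge gamma.
have {}gtE : transpose gamma = gt by apply/funext => E; rewrite gtE.
rewrite /reduced gtE; apply: sf_meet_eq0P => //.
by rewrite -gtE; exact: (transpose_sf_le g0).
Qed.

(** The transpose of the meet is again a lower bound of [eta] and its transpose,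
    hence below the meet; so the meet is symmetric, and a symmetric measure has
    equal marginals. *)
Lemma meet_transpose_circulation eta : sf_le (cst 0) eta ->
  exists tau : {charge set (J * J)%type -> \bar R},
    [/\ sf_eq tau (sf_meet eta (transpose eta)), sf_le (cst 0) tau,
        sf_le tau eta & circulation tau].
Proof.
move=> eta0; have [et etE] := transpose_charge eta.
have {}etE : transpose eta = et by apply/funext => E; rewrite etE.
have [t tE] := sf_meet_charge eta et.
have t_eta : sf_le t eta by move=> E mE; rewrite tE//; exact: sf_meet_lel.
have t_et : sf_le t et by move=> E mE; rewrite tE//; exact: sf_meet_ler.
have et0 : sf_le (cst 0) et by rewrite -etE; exact: (transpose_sf_le eta0).
have [tt ttE] := transpose_charge t.
have {}ttE : transpose t = tt by apply/funext => E; rewrite ttE.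
have tt_t : sf_le tt t.
  move=> E mE; rewrite tE//; apply: sf_meet_glb => //.
    by rewrite -ttE -(transposeK eta) etE; exact: transpose_sf_le.
  by rewrite -ttE -etE; exact: transpose_sf_le.
have t_tt : sf_le t tt.
  by rewrite -{1}(transposeK t) -ttE; apply: transpose_sf_le; rewrite ttE.
exists t; split => //.
- by rewrite etE.
- by move=> E mE; rewrite tE//; exact: (sf_meet_glb (c := czero)).
- move=> X mX; rewrite -transposeX; apply/eqP; rewrite eq_le ttE.
  by rewrite tt_t ?t_tt//; exact: measurableX.
Qed.

(** Reversing the part of [gamma] that lies under the transpose of [eta] gives
    a signed circulation; it vanishes only if [gamma] is symmetric, which
    contradicts reducedness. *)
Lemma unfold_circulation eta gamma :
  sf_le (cst 0) eta -> reduced eta ->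
  circulation gamma -> reduced gamma -> sf_le (cst 0) gamma ->
  ~ sf_eq gamma (cst 0) -> sf_le gamma (eta \+ transpose eta) ->
  exists nu : {charge set (J * J)%type -> \bar R},
    [/\ sf_le nu eta, sf_le (\- nu) eta, circulation nu &
        ~ sf_eq nu (cst 0)].
Proof.
move=> eta0 /(reducedP eta0)[G [mG etaG etaCG]] gcirc gred g0 gn0 gle.
have mCG := measurableC mG.
have et0 : sf_le (cst 0) (transpose eta) by exact: (transpose_sf_le eta0).
have [et etE] := transpose_charge eta.
have {}etE : transpose eta = et by apply/funext => E; rewrite etE.
rewrite etE in etaCG gle et0.
have g1le E : measurable E -> gamma (E `&` ~` G) <= eta E.
  move=> mE; have mI : measurable (E `&` ~` G) by exact: measurableI.
  apply: le_trans (gle _ mI) _; rewrite -[leRHS]adde0; apply: leeD.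
    by apply: nonneg_charge_le => //; exact: subIsetl.
  by rewrite -etaCG; apply: nonneg_charge_le => //; exact: subIsetr.
have g2le E : measurable E -> gamma (E `&` G) <= et E.
  move=> mE; have mI : measurable (E `&` G) by exact: measurableI.
  apply: le_trans (gle _ mI) _; rewrite -[leRHS]add0e; apply: leeD.
    by rewrite -etaG; apply: nonneg_charge_le => //; exact: subIsetr.
  by apply: nonneg_charge_le => //; exact: subIsetl.
have [g2t g2tE] := transpose_charge (crestr gamma mG).
pose E' E := [set xy : J * J | E (xy.2, xy.1)].
have {}g2tE E : g2t E = gamma (E' E `&` G) by rewrite g2tE.
have E'K E : E' (E' E) = E by apply/funext => -[].
have g2tle E : measurable E -> g2t E <= eta E.
  move=> mE; rewrite g2tE -[in leRHS](E'K E) -[leRHS]/(transpose eta (E' E)) etE.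
  by apply: g2le; exact: measurable_transpose.
pose nu : {charge set (J * J)%type -> \bar R} :=
  cadd (crestr gamma mCG) (copp g2t).
have nuE E : nu E = gamma (E `&` ~` G) - g2t E by [].
have mIC E : measurable E -> measurable (E `&` ~` G).
  by move=> mE; exact: measurableI.
have mI E : measurable E -> measurable (E `&` G).
  by move=> mE; exact: measurableI.
have g2t0 E : measurable E -> 0 <= g2t E.
  by move=> mE; rewrite g2tE; apply: g0; apply: mI; exact: measurable_transpose.
have g10 E : measurable E -> 0 <= gamma (E `&` ~` G).
  by move=> mE; apply: g0; exact: mIC.
exists nu; split.
- move=> E mE; rewrite nuE; apply: le_trans (g1le _ mE).
  by rewrite geeDl// leeNl oppe0 g2t0.
- move=> E mE; rewrite /= nuE; apply: le_trans (g2tle _ mE).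
  have m1 := mIC _ mE; have := g10 _ mE.
  real_value (gamma (E `&` ~` G)); real_value (g2t E).
  by rewrite -EFinB -EFinN !lee_fin => ?; lra.
- move=> X mX; rewrite !nuE !g2tE.
  have -> : E' (X `*` setT) = setT `*` X.
    by rewrite /E'; apply/seteqP; split=> -[x y] /=; tauto.
  have -> : E' (setT `*` X) = X `*` setT.
    by rewrite /E'; apply/seteqP; split=> -[x y] /=; tauto.
  have m1 : measurable (X `*` [set: J]) by exact: measurableX.
  have m2 : measurable ([set: J] `*` X) by exact: measurableX.
  have := gcirc _ mX; rewrite (chargeID gamma m1 mG) (chargeID gamma m2 mG).
  rewrite !setDE.
  real_value (gamma (X `*` setT `&` G)); real_value (gamma (setT `*` X `&` G)).
  real_value (gamma (X `*` setT `&` ~` G)).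
  real_value (gamma (setT `*` X `&` ~` G)).
  by rewrite -!EFinD => -[h]; congr EFin; lra.
- move=> nu0; apply: gn0 => E mE.
  (* If [nu] vanishes, the two parts of [gamma] are transposes of each other. *)
  have g12 F : measurable F -> gamma (F `&` ~` G) = gamma (E' F `&` G).
    move=> mF; have := nu0 _ mF; rewrite nuE g2tE.
    have m1 := mIC _ mF.
    have m2 : measurable (E' F `&` G) by exact: mI (measurable_transpose mF).
    real_value (gamma (F `&` ~` G)).
    by real_value (gamma (E' F `&` G)); rewrite -EFinB => -[h]; congr EFin; lra.
  have symm : sf_eq (transpose gamma) gamma.
    move=> F mF; have mtF := measurable_transpose mF.
    rewrite -[LHS]/(gamma (E' F)) (chargeID gamma mtF mG) (chargeID gamma mF mG).
    by rewrite !setDE -g12// [X in _ + X]g12// E'K addeC.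
  apply/eqP; rewrite eq_le g0// andbT -(gred _ mE).
  have [gt gtE] := transpose_charge gamma.
  have {}gtE : transpose gamma = gt by apply/funext => F; rewrite gtE.
  rewrite gtE; apply: (sf_meet_glb (c := gamma)) => //.
  by rewrite -gtE => F mF; rewrite symm.
Qed.

(** Reversing the negative part of a signed circulation gives a nonnegative
    one. *)
Lemma fold_circulation eta nu :
  sf_le (cst 0) eta -> reduced eta ->
  sf_le nu eta -> sf_le (\- nu) eta -> circulation nu -> ~ sf_eq nu (cst 0) ->
  exists gamma : {charge set (J * J)%type -> \bar R},
    [/\ circulation gamma, reduced gamma, sf_le (cst 0) gamma,
        ~ sf_eq gamma (cst 0) & sf_le gamma (eta \+ transpose eta)].
Proof.
move=> eta0 /(reducedP eta0)[G [mG etaG etaCG]] nule nuNle nucirc nun0.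
have mCG := measurableC mG.
pose E' E := [set xy : J * J | E (xy.2, xy.1)].
have E'K E : E' (E' E) = E by apply/funext => -[].
have mE' E : measurable E -> measurable (E' E) by exact: measurable_transpose.
have [P [N [[mP posP] [mN negN] PNT PN0]]] := Hahn_decomposition nu.
pose npos : {charge set (J * J)%type -> \bar R} := crestr nu mP.
pose nneg : {charge set (J * J)%type -> \bar R} := copp (crestr nu mN).
have nposE E : npos E = nu (E `&` P) by [].
have nnegE E : nneg E = - nu (E `&` N) by [].
have mIP E : measurable E -> measurable (E `&` P) by move=> ?; exact: measurableI.
have mIN E : measurable E -> measurable (E `&` N) by move=> ?; exact: measurableI.
have pos0 : sf_le (cst 0) npos.
  by move=> E mE; rewrite nposE; apply: posP; [exact: mIP|exact: subIsetr].
have neg0 : sf_le (cst 0) nneg.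
  move=> E mE; rewrite nnegE leeNr oppe0.
  by apply: negN; [exact: mIN|exact: subIsetr].
have pos_eta : sf_le npos eta.
  move=> E mE; rewrite nposE; apply: le_trans (nule _ (mIP _ mE)) _.
  by apply: nonneg_charge_le => //; exact: mIP.
have neg_eta : sf_le nneg eta.
  move=> E mE; rewrite nnegE; apply: le_trans (nuNle _ (mIN _ mE)) _.
  by apply: nonneg_charge_le => //; exact: mIN.
have nuE E : measurable E -> nu E = npos E - nneg E.
  by move=> mE; rewrite nposE nnegE oppeK; exact: charge_partition.
have [nt ntE] := transpose_charge nneg.
have {}ntE E : nt E = nneg (E' E) by rewrite ntE.
pose gamma : {charge set (J * J)%type -> \bar R} := cadd npos nt.
have gE E : gamma E = npos E + nneg (E' E) by rewrite -ntE.
have g0 : sf_le (cst 0) gamma.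
  by move=> E mE; rewrite gE; apply: adde_ge0; [exact: pos0|exact: (neg0 _ (mE' _ mE))].
have null (a : {charge set (J * J)%type -> \bar R}) A B :
    sf_le (cst 0) a -> measurable A -> measurable B -> A `<=` B -> a B = 0 ->
    a A = 0.
  move=> a0 mA mB AB aB; apply/eqP; rewrite eq_le; apply/andP; split.
    by rewrite -aB; exact: nonneg_charge_le.
  exact: a0.
have below (a : {charge set (J * J)%type -> \bar R}) A :
    sf_le (cst 0) a -> sf_le a eta -> measurable A -> eta A = 0 -> a A = 0.
  move=> a0 ae mA eA; apply/eqP; rewrite eq_le a0// andbT -eA; exact: ae.
have etaG' : eta (E' (~` G)) = 0 by [].
have npP : npos N = 0 by rewrite nposE setIC PN0 charge0.
have nnN : nneg P = 0 by rewrite nnegE PN0 charge0 oppe0.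
have CP : ~` P = N.
  apply/seteqP; split => x.
    by move=> Px; have : [set: J * J] x by []; rewrite -PNT => -[].
  by move=> Nx Px; have : (P `&` N) x by []; rewrite PN0.
have CN : ~` N = P by rewrite -CP setCK.
have posG := below _ _ pos0 pos_eta mG etaG.
have negG := below _ _ neg0 neg_eta mG etaG.
have posG' := below _ _ pos0 pos_eta (mE' _ mCG) etaG'.
have negG' := below _ _ neg0 neg_eta (mE' _ mCG) etaG'.
exists gamma; split => //.
- move=> X mX; rewrite !gE.
  have -> : E' (X `*` setT) = setT `*` X.
    by rewrite /E'; apply/seteqP; split=> -[x y] /=; tauto.
  have -> : E' (setT `*` X) = X `*` setT.
    by rewrite /E'; apply/seteqP; split=> -[x y] /=; tauto.
  have m1 : measurable (X `*` [set: J]) by exact: measurableX.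
  have m2 : measurable ([set: J] `*` X) by exact: measurableX.
  have := nucirc _ mX; rewrite !nuE//.
  real_value (npos (X `*` setT)); real_value (npos (setT `*` X)).
  real_value (nneg (X `*` setT)); real_value (nneg (setT `*` X)).
  by rewrite -!EFinD => -[h]; congr EFin; lra.
- apply/(reducedP g0).
  (* [gamma] is carried by [~` G `&` P], where the positive part of [nu] lives,
     and [G `&` E' N], where its reversed negative part does; the two sets
     below make up the complement. *)
  exists ((~` G `&` N) `|` (G `&` E' P)).
  have mE'P := mE' _ mP; have mE'N := mE' _ mN.
  have m1 : measurable (~` G `&` N) by exact: measurableI.
  have m2 : measurable (G `&` E' P) by exact: measurableI.
  have m3 : measurable (~` G `&` P) by exact: measurableI.
  have m4 : measurable (G `&` E' N) by exact: measurableI.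
  have gnull A B C : measurable A -> measurable B -> measurable C ->
      A `<=` B -> E' A `<=` C -> npos B = 0 -> nneg C = 0 -> gamma A = 0.
    move=> mA mB mC AB AC pB nC; rewrite gE (null npos A B)// (null nneg _ C)//.
    - by rewrite adde0.
    - exact: mE'.
  split; first exact: measurableU.
  + rewrite chargeU//.
      rewrite (gnull _ N (E' (~` G)))//; [|exact: mE'|by move=> x []].
      by rewrite (gnull _ G P)// ?adde0// => -[x y] [].
    by apply/seteqP; split => // x [[]] /= ? _ [].
  + have -> : ~` ((~` G `&` N) `|` (G `&` E' P)) =
        (~` G `&` P) `|` (G `&` E' N).
      rewrite -CP; apply/seteqP; split => -[x y] /=.
        have := pselect (G (x, y)); have := pselect (P (x, y)).
        have := pselect (P (y, x)); rewrite /E' /=; tauto.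
      by rewrite /E' /=; tauto.
    rewrite -[LHS]/(gamma (E' (~` G `&` P) `|` E' (G `&` E' N))).
    rewrite chargeU; [|exact: mE'|exact: mE'|].
      rewrite (gnull _ (E' (~` G)) P)//;
        [|exact: mE'|exact: mE'|by move=> x []|by move=> [x y] []].
      by rewrite (gnull _ N G) ?adde0//; [exact: mE'|move=> [x y] []|move=> [x y] []].
    by apply/seteqP; split => // -[x y] [[]] /= ? _ [].
- move=> gam0; apply: nun0 => E mE.
  have pE0 : npos E = 0.
    apply/eqP; rewrite eq_le pos0// andbT -[leRHS](gam0 _ mE) gE leeDl//.
    exact: (neg0 _ (mE' _ mE)).
  have nE0 : nneg E = 0.
    apply/eqP; rewrite eq_le neg0// andbT -[leRHS](gam0 _ (mE' _ mE)) gE E'K.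
    by rewrite leeDr//; exact: (pos0 _ (mE' _ mE)).
  by rewrite nuE// pE0 nE0 sube0.
- move=> E mE; rewrite gE; apply: leeD; first exact: pos_eta.
  exact: (neg_eta _ (mE' _ mE)).
Qed.

(** * Perturbations of a flow *)

Section ExtremeFlow.
Variables (phi : set J -> R) (alpha beta mu : {charge set (J * J)%type -> \bar R}).
Hypothesis muF : flows phi alpha beta mu.
Let eta := sf_meet (beta \- mu) (mu \- alpha).
Let psi := (EFin \o phi) \- boundary mu.

Let bma : {charge set (J * J)%type -> \bar R} := cadd beta (copp mu).
Let mma : {charge set (J * J)%type -> \bar R} := cadd mu (copp alpha).

Lemma residual_charge : exists e : {charge set (J * J)%type -> \bar R},
  sf_eq e eta /\ sf_le (cst 0) e.
Proof.
have [e eE] := sf_meet_charge bma mma.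
have [amu mub _] := muF.
exists e; split=> // E mE; rewrite eE//; apply: (@sf_meet_glb _ _ _ _ _ czero) => //.
- move=> F mF; rewrite [leRHS](_ : _ = beta F - mu F)//.
  by have := mub _ mF; real_value (beta F); real_value (mu F);
    rewrite -EFinB !lee_fin subr_ge0.
- move=> F mF; rewrite [leRHS](_ : _ = mu F - alpha F)//.
  by have := amu _ mF; real_value (mu F); real_value (alpha F);
    rewrite -EFinB !lee_fin subr_ge0.
Qed.

Lemma flows_perturb (nu : {charge set (J * J)%type -> \bar R}) :
  sf_le nu eta -> sf_le (\- nu) eta -> sf_le (boundary nu) psi ->
  flows phi alpha beta (cadd mu nu).
Proof.
move=> nule nuNle nupsi.
have addE E : (cadd mu nu : {charge set (J * J)%type -> \bar R}) E = mu E + nu E.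
  by [].
split=> E mE.
- have : - nu E <= mu E - alpha E.
    exact: le_trans (nuNle _ mE) (sf_meet_ler bma mma mE).
  rewrite addE; real_value (nu E); real_value (mu E); real_value (alpha E).
  by rewrite -EFinB -EFinN -EFinD !lee_fin => ?; lra.
- have : nu E <= beta E - mu E.
    exact: le_trans (nule _ mE) (sf_meet_lel bma mma mE).
  rewrite addE; real_value (nu E); real_value (mu E); real_value (beta E).
  by rewrite -EFinB -EFinD !lee_fin => ?; lra.
- have := nupsi _ mE; rewrite /psi /boundary /= !addE.
  real_value (nu (E `*` ~` E)); real_value (mu (E `*` ~` E)).
  real_value (nu (~` E `*` E)); real_value (mu (~` E `*` E)).
  by rewrite -!EFinB -?EFinD -?EFinB !lee_fin => ?; lra.
Qed.

Lemma boundaryN (nu : {charge set (J * J)%type -> \bar R}) X : measurable X ->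
  boundary (copp nu) X = - boundary nu X.
Proof.
move=> mX; rewrite /boundary.
rewrite [LHS](_ : _ = - nu (X `*` ~` X) - - nu (~` X `*` X))//.
real_value (nu (X `*` ~` X)); real_value (nu (~` X `*` X)).
by rewrite -!EFinB -!EFinN; congr EFin; lra.
Qed.

(** Extremality only sees the segments centred at [mu]: their half-lengths are
    the measures dominated by the residual capacity [eta], with boundary
    dominated by the residual demand [psi]. *)
Lemma extreme_flowP :
  extreme_point (flows phi alpha beta) mu <->
  forall nu : {charge set (J * J)%type -> \bar R},
    sf_le nu eta -> sf_le (\- nu) eta ->
    sf_le (boundary nu) psi -> sf_le (\- boundary nu) psi ->
    sf_eq nu (cst 0).
Proof.
split=> [[_ ext] nu nule nuNle nupsi nuNpsi|H].
  apply: contrapT => nu0; apply: ext.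
  pose mu1 : {charge set (J * J)%type -> \bar R} := cadd mu nu.
  pose mu2 : {charge set (J * J)%type -> \bar R} := cadd mu (copp nu).
  have mu1E E : mu1 E = mu E + nu E by [].
  have mu2E E : mu2 E = mu E - nu E by [].
  exists mu1, mu2; split.
  - exact: flows_perturb.
  - apply: flows_perturb => // E mE.
      by rewrite [leLHS](_ : _ = - - nu E)// oppeK; exact: nule.
    by rewrite boundaryN//; exact: nuNpsi.
  - move=> h; apply: nu0 => E mE; have := h _ mE; rewrite mu1E mu2E.
    real_value (mu E); real_value (nu E).
    by rewrite -EFinB -EFinD => -[h']; congr EFin; lra.
  - move=> E mE; rewrite mu1E mu2E.
    real_value (mu E); real_value (nu E).
    by rewrite -EFinB -!EFinD -EFinM; congr EFin; lra.
split=> // -[mu1 [mu2 [F1 F2 n12 muE]]].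
have mid E : measurable E -> mu1 E - mu E = mu E - mu2 E.
  move=> mE; have := muE _ mE.
  real_value (mu E); real_value (mu1 E); real_value (mu2 E).
  by rewrite -!EFinB -EFinD -EFinM => -[h]; congr EFin; lra.
pose nu : {charge set (J * J)%type -> \bar R} := cadd mu1 (copp mu).
have nuE E : nu E = mu1 E - mu E by [].
have bnuE X : measurable X -> boundary nu X = boundary mu1 X - boundary mu X /\
    - boundary nu X = boundary mu2 X - boundary mu X.
  move=> mX; have := mid _ (measurable_XC mX); have := mid _ (measurable_CX mX).
  rewrite /boundary !nuE.
  real_value (mu (X `*` ~` X)); real_value (mu (~` X `*` X)).
  real_value (mu1 (X `*` ~` X)); real_value (mu1 (~` X `*` X)).
  real_value (mu2 (X `*` ~` X)); real_value (mu2 (~` X `*` X)).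
  by rewrite -!EFinB -!EFinN => -[h1] [h2]; split; congr EFin; lra.
have [a1 b1 p1] := F1; have [a2 b2 p2] := F2.
have nu0 : sf_eq nu (cst 0).
  apply: H.
  - apply: (sf_meet_glb (a := bma) (b := mma)) => E mE; rewrite nuE.
      rewrite [leRHS](_ : _ = beta E - mu E)//.
      by apply: leeB => //; exact: b1.
    rewrite mid// [leRHS](_ : _ = mu E - alpha E)//.
    by apply: leeB => //; exact: a2.
  - have le1 : sf_le (copp nu) bma.
      move=> E mE; rewrite [leLHS](_ : _ = - nu E)// nuE mid//.
      rewrite [leRHS](_ : _ = beta E - mu E)//.
      have := b2 _ mE.
      real_value (beta E); real_value (mu E); real_value (mu2 E).
      by rewrite -!EFinB -EFinN !lee_fin => ?; lra.
    have le2 : sf_le (copp nu) mma.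
      move=> E mE; rewrite [leLHS](_ : _ = - nu E)// nuE.
      rewrite [leRHS](_ : _ = mu E - alpha E)//.
      have := a1 _ mE.
      real_value (alpha E); real_value (mu E); real_value (mu1 E).
      by rewrite -!EFinB -EFinN !lee_fin => ?; lra.
    exact: sf_meet_glb le1 le2.
  - move=> X mX; have [-> _] := bnuE _ mX.
    by apply: leeB => //; exact: p1.
  - move=> X mX /=; have [_ ->] := bnuE _ mX.
    by apply: leeB => //; exact: p2.
apply: n12 => E mE; have := nu0 _ mE; rewrite nuE; have := mid _ mE.
real_value (mu E); real_value (mu1 E); real_value (mu2 E).
by rewrite -!EFinB => -[h1] [h2]; congr EFin; lra.
Qed.

End ExtremeFlow.

End Flows.

Local Open Scope ereal_scope.

Theorem theorem4p4 (R : realType) (d : measure_display) (J : measurableType d)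
    (hJ : standard_borel R J)
    (alpha beta : {charge set (J * J)%type -> \bar R})
    (hab : sf_le alpha beta)
    (phi : set J -> R)
    (phi_bounded : sf_bounded phi)
    (phi_continuous : sf_continuous phi)
    (phi_submodular : submodular phi)
    (phi0 : phi set0 = 0%R) (phiJ : phi [set: J] = 0%R)
    (mu : {charge set (J * J)%type -> \bar R})
    (hmu : flows phi alpha beta mu) :
  let eta := sf_meet (beta \- mu) (mu \- alpha) in
  let rho := eta \+ transpose eta in
  let tau := sf_meet eta (transpose eta) in
  let psi := (EFin \o phi) \- boundary mu in
  extreme_point (flows phi alpha beta) mu <->
  (bmm (cut_function (\- eta) eta) `&` bmm psi `&` bmm (sf_compl psi) =
     [set delta : {additive_charge set J -> \bar R} |
        sf_eq delta (cst 0)]) /\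
  (sf_eq tau (cst 0) /\
   ~ exists gamma : {charge set (J * J)%type -> \bar R},
       [/\ circulation gamma, reduced gamma,
           (* 0 < gamma *)
           sf_le (cst 0) gamma,
           ~ sf_eq gamma (cst 0) &
           sf_le gamma rho]).
Proof.
move=> eta rho tau psi.
(* [eta] is infinite off the measurable sets; [e] is a charge equal to it on
   them. *)
have [e [eE e0]] : exists e : {charge set (J * J)%type -> \bar R},
    sf_eq e eta /\ sf_le (cst 0) e := residual_charge hmu.
have etaE : sf_eq eta e by move=> E mE; rewrite eE.
have tetaE : sf_eq (transpose eta) (transpose e).
  by move=> E mE; apply: etaE; exact: measurable_transpose.
have tauE : tau = sf_meet e (transpose e) := sf_meet_eq etaE tetaE.
have rhoE : sf_eq rho (e \+ transpose e).
  by move=> E mE; rewrite /rho /= etaE// tetaE.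
have cutE X : measurable X ->
    cut_function (\- eta) eta X = cut_function (\- e) e X.
  move=> mX; rewrite /cut_function /= !etaE//.
    exact: measurable_CX.
  exact: measurable_XC.
have mC (X : set J) : measurable X -> measurable (~` X) := @measurableC _ _ X.
have psi_ge0 X : measurable X -> 0 <= psi X.
  move=> mX; have [_ _ /(_ _ mX)] := hmu; rewrite /psi /=.
  by rewrite -(fineK (boundary_fin mu mX)) -EFinB !lee_fin subr_ge0.
have psi0 : psi set0 = 0.
  by rewrite /psi /= phi0 -[set0]setCT boundaryC// boundaryT oppe0 sube0.
have psiT : psi setT = 0 by rewrite /psi /= phiJ boundaryT sube0.
have cut0 X : measurable X -> 0 <= cut_function (\- e) e X.
  move=> mX; rewrite /cut_function oppeK; apply: adde_ge0; apply: e0.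
    exact: measurable_XC.
  exact: measurable_CX.
have cutT : cut_function (\- e) e setT = 0.
  by rewrite /cut_function setCT setX0 set0X !charge0 oppeK adde0.
have toeta (nu : set (J * J)%type -> \bar R) : sf_le nu e -> sf_le nu eta.
  by move=> h E mE; rewrite etaE//; exact: h.
have ofeta (nu : set (J * J)%type -> \bar R) : sf_le nu eta -> sf_le nu e.
  by move=> h E mE; rewrite -etaE//; exact: h.
have ext := extreme_flowP hmu.
split=> [/ext H|[H1 [H2 H3]]].
- have Hcirc (nu : {charge set (J * J)%type -> \bar R}) : sf_le nu e ->
      sf_le (\- nu) e -> circulation nu -> sf_eq nu (cst 0).
    move=> nule nuNle /circulationP nuc.
    apply: H; [exact: toeta|exact: toeta| |] => X mX.
      by rewrite nuc//; exact: psi_ge0.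
    by rewrite -[leRHS]/(psi X) /= nuc// oppe0; exact: psi_ge0.
  (* The meet of [eta] and its transpose is itself a perturbation. *)
  have tau0 : sf_eq tau (cst 0).
    have [t [tE t0 te tc]] := meet_transpose_circulation e0.
    have t00 : sf_eq t (cst 0).
      apply: Hcirc => // E mE /=; apply: (@le_trans _ _ 0); last exact: e0.
      by rewrite leeNl oppe0; exact: t0.
    by move=> E mE; rewrite tauE -tE// t00.
  split.
  + apply/seteqP; split=> delta; last first.
      move=> d0; split; first split; split.
      * by move=> X mX; rewrite d0// cutE//; exact: cut0.
      * by rewrite d0// cutE.
      * by move=> X mX; rewrite d0//; exact: psi_ge0.
      * by rewrite d0.
      * by move=> X mX; rewrite d0//; apply: psi_ge0; exact: mC.
      * by rewrite d0// /sf_compl setCT.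
    move=> [[[dcut dT] [dpsi _]] [dpsiC _]].
    have dT0 : delta setT = 0 by rewrite dT cutE.
    have [|nu [nule nuNle nub]] := cut_lift e0 _ dT0.
      by move=> X mX; rewrite -cutE//; exact: dcut.
    have nu0 : sf_eq nu (cst 0).
      apply: H; [exact: toeta|exact: toeta| |] => X mX.
        by rewrite nub//; exact: dpsi.
      rewrite /= -boundaryC// nub; last exact: mC.
      by have := dpsiC _ (mC _ mX); rewrite /sf_compl setCK.
    move=> X mX; rewrite -nub// /boundary nu0 ?nu0 ?sube0//.
      exact: measurable_CX.
    exact: measurable_XC.
  + split=> // -[gamma [gc gr g0 gn0 gle]].
    have ered : reduced e by rewrite /reduced -tauE.
    have [|nu [nule nuNle nuc nun0]] :=
        unfold_circulation e0 ered gc gr g0 gn0.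
      by move=> E mE; rewrite -rhoE//; exact: gle.
    by apply: nun0; exact: Hcirc.
- apply/ext => nu nule nuNle nupsi nuNpsi.
  have [c0 c0E] := boundary_charge nu.
  pose c : {additive_charge set J -> \bar R} := c0.
  have cE : sf_eq c (boundary nu) := c0E.
  have ckey : (bmm (cut_function (\- eta) eta) `&` bmm psi `&` bmm (sf_compl psi)) c.
    have cT : c setT = 0 by rewrite cE// boundaryT.
    split; first split; split.
    + move=> X mX; rewrite cutE// cE// /boundary /cut_function oppeK.
      apply: leeD; first by apply: (ofeta _ nule); exact: measurable_XC.
      by apply: (ofeta _ nuNle); exact: measurable_CX.
    + by rewrite cutE// cutT.
    + by move=> X mX; rewrite cE//; exact: nupsi.
    + by rewrite psiT.
    + move=> X mX; rewrite cE// -[X in boundary nu X]setCK boundaryC; last exact: mC.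
      by apply: nuNpsi; exact: mC.
    + by rewrite /sf_compl setCT psi0.
  have {}ckey : sf_eq c (cst 0) by move: ckey; rewrite H1.
  apply: contrapT => nun0; apply: H3.
  have ered : reduced e by rewrite /reduced -tauE.
  have nuc : circulation nu.
    by apply/circulationP => X mX; rewrite -cE// ckey.
  have [gamma [gc gr g0 gn0 gle]] :=
    fold_circulation e0 ered (ofeta _ nule) (ofeta _ nuNle) nuc nun0.
  exists gamma; split=> // E mE.
  by rewrite rhoE//; exact: gle.
Qed.
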